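(* (1) For formulae in ${\rm FO}(=\!(\cdot,\cdot))$, $\models_{\text{rel}}$ and $\models_{\text{prob}}$ coincide. (2) If $\psi \in {\rm FO}(=\!(\cdot,\cdot)), \varphi \in {\rm FO}(\perp)$, then $\psi \models_{\text{prob}} \varphi \implies \psi \models_{\text{rel}} \varphi$. (3) If $\psi \in {\rm FO}(\perp)$ and $\varphi \in {\rm FO}(=\!(\cdot,\cdot))$, then $\psi \models_{\text{rel}} \varphi \implies \psi \models_{\text{prob}} \varphi$. (4) For $\varphi, \psi \in {\rm FO}(\perp)$, neither implication holds in general. Conjunctions of conditional independence atoms suffice to generate counterexamples.
   Context: Teams, probabilistic teams $\mathbb{X}=(X,\mathbb{P})$ (with $X$ the support of $\mathbb{P}$), dependence logic ${\rm FO}(=\!(\cdot,\cdot))$ (first-order literals and dependence atoms $=\!(\bar x,\bar y)$) and independence logic ${\rm FO}(\perp)$ (first-order literals and conditional independence atoms $\bar x\perp_{\bar z}\bar y$), closed under $\land,\lor,\exists,\forall$, are evaluated both in relational team semantics and in probabilistic team semantics (where $=\!(\bar x,\bar y)$ means that $\bar y$ is determined by $\bar x$ with conditional probability 1, $\bar x\perp_{\bar z}\bar y$ means conditional stochastic independence, disjunction is a convex split, $\forall$ is the uniform extension and $\exists$ a probabilistic Skolem extension). For $\psi,\varphi\in{\rm FO}(\perp)$, $\psi\models_{\text{rel}}\varphi$ means every relational team satisfying $\psi$ satisfies $\varphi$, and $\psi\models_{\text{prob}}\varphi$ is the same for probabilistic teams. It is known that for every probabilistic team $\mathbb{X}$ with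 underlying team $X$, $\mathbb{X}\models\psi$ implies $X\models\psi$ for $\psi\in{\rm FO}(\perp)$, with equivalence for $\psi\in{\rm FO}(=\!(\cdot,\cdot))$. *)

(* Defs.v *)
From HB Require Import structures.
From mathcomp Require Import all_boot all_order all_algebra finmap reals.

Set Implicit Arguments.
Unset Strict Implicit.
Unset Printing Implicit Defensive.
Import Order.TTheory GRing.Theory Num.Theory.
Local Open Scope fset_scope.
Local Open Scope ring_scope.

Record signature := Signature {
  fsym : Type; far : fsym -> nat;
  rsym : Type; rar : rsym -> nat }.

Section Syntax.
Variable L : signature.

Inductive term :=
| Var of nat
| App (f : fsym L) of 'I_(far f) -> term.

Inductive literal :=
| Eq of term & term
| Neq of term & term
| Rel (r : rsym L) of 'I_(rar r) -> term
| NRel (r : rsym L) of 'I_(rar r) -> term.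

(* [Dep xs ys] is =(xs, ys); [Ind xs zs ys] is xs _|_zs ys, with the          *)
(* conditioning tuple in the middle.                                          *)
Inductive formula :=
| Lit of literal
| Dep of seq nat & seq nat
| Ind of seq nat & seq nat & seq nat
| And of formula & formula
| Or of formula & formula
| Exists of nat & formula
| Forall of nat & formula.

Fixpoint fv_term (t : term) : {fset nat} :=
  match t with
  | Var x => [fset x]
  | App f ts => \bigcup_(i <- enum 'I_(far f)) fv_term (ts i)
  end.

Definition fv_lit (l : literal) : {fset nat} :=
  match l with
  | Eq t u | Neq t u => fv_term t `|` fv_term u
  | Rel r ts | NRel r ts => \bigcup_(i <- enum 'I_(rar r)) fv_term (ts i)
  end.

Fixpoint fv (phi : formula) : {fset nat} :=
  match phi with
  | Lit l => fv_lit l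
  | Dep xs ys => [fset x in xs ++ ys]
  | Ind xs zs ys => [fset x in xs ++ zs ++ ys]
  | And p q | Or p q => fv p `|` fv q
  | Exists x p | Forall x p => fv p `\ x
  end.

Fixpoint FOdep (phi : formula) : bool :=
  match phi with
  | Lit _ | Dep _ _ => true
  | Ind _ _ _ => false
  | And p q | Or p q => FOdep p && FOdep q
  | Exists _ p | Forall _ p => FOdep p
  end.

Fixpoint FOind (phi : formula) : bool :=
  match phi with
  | Lit _ | Ind _ _ _ => true
  | Dep _ _ => false
  | And p q | Or p q => FOind p && FOind q
  | Exists _ p | Forall _ p => FOind p
  end.

Fixpoint ind_conj (phi : formula) : bool :=
  match phi with
  | Ind _ _ _ => true
  | And p q => ind_conj p && ind_conj q
  | _ => false
  end.

Lemma ind_conj_FOind phi : ind_conj phi -> FOind phi.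
Proof. by elim: phi => //= p IHp q IHq /andP[/IHp -> /IHq ->]. Qed.

(* Structures are finite: the uniform extension interpreting the universal    *)
(* quantifier in probabilistic teams needs this. [pt] makes the universe      *)
(* nonempty; semantically it only matters for variables outside the domain of *)
(* a team, which the entailment relations below exclude.                      *)
Record structure := Structure {
  univ :> finType;
  pt : univ;
  fint : forall f : fsym L, (far f).-tuple univ -> univ;
  rint : forall r : rsym L, (rar r).-tuple univ -> bool }.

End Syntax.

Section Semantics.
Variables (L : signature) (A : structure L).

Definition asg (D : {fset nat}) := {ffun D -> A}.

Definition val_at (D : {fset nat}) (s : asg D) (x : nat) : A :=
  if insub x is Some y then s y else pt A.

Definition vals (D : {fset nat}) (s : asg D) (xs : seq nat) : seq A :=
  map (val_at s) xs.

(* s(a/x): overwrites x if x is already in D. *)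
Definition upd (D : {fset nat}) (s : asg D) (x : nat) (a : A) : asg (x |` D) :=
  [ffun y => if val y == x then a else val_at s (val y)].

Fixpoint eval (D : {fset nat}) (s : asg D) (t : term L) : A :=
  match t with
  | Var x => val_at s x
  | App f ts => fint [tuple eval s (ts i) | i < far f]
  end.

Definition lit_holds (D : {fset nat}) (s : asg D) (l : literal L) : bool :=
  match l with
  | Eq t u => eval s t == eval s u
  | Neq t u => eval s t != eval s u
  | Rel r ts => rint [tuple eval s (ts i) | i < rar r]
  | NRel r ts => ~~ rint [tuple eval s (ts i) | i < rar r]
  end.

Definition team (D : {fset nat}) := {set asg D}.

Definition ex_team (D : {fset nat}) (X : team D) (x : nat)
    (F : asg D -> {set A}) : team (x |` D) :=
  [set upd s x a | s in X, a in F s].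

Definition all_team (D : {fset nat}) (X : team D) (x : nat) : team (x |` D) :=
  [set upd s x a | s in X, a in [set: A]].

(* Lax semantics: the two parts of a split may overlap, and the existential    *)
(* quantifier picks a nonempty set of witnesses.                              *)
Fixpoint sat (phi : formula L) : forall D : {fset nat}, team D -> Prop :=
  match phi with
  | Lit l => fun D X => forall s, s \in X -> lit_holds s l
  | Dep xs ys => fun D X => forall s s', s \in X -> s' \in X ->
      vals s xs = vals s' xs -> vals s ys = vals s' ys
  | Ind xs zs ys => fun D X => forall s s', s \in X -> s' \in X ->
      vals s zs = vals s' zs ->
      exists s'', [/\ s'' \in X, vals s'' zs = vals s zs,
                      vals s'' xs = vals s xs & vals s'' ys = vals s' ys]
  | And p q => fun D X => sat p X /\ sat q X
  | Or p q => fun D X =>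
      exists Y Z : team D, [/\ X = Y :|: Z, sat p Y & sat q Z]
  | Exists x p => fun D X => exists F : asg D -> {set A},
      (forall s, s \in X -> F s != set0) /\ sat p (ex_team X x F)
  | Forall x p => fun D X => sat p (all_team X x)
  end.

Variable R : realType.

Definition distr (T : finType) (p : T -> R) : Prop :=
  (forall t, 0 <= p t) /\ \sum_t p t = 1.

(* A probabilistic team with variable domain D is a P : pteam D such that     *)
(* [distr P]; its underlying team is [psupp P].                               *)
Definition pteam (D : {fset nat}) := {ffun asg D -> R}.

Definition psupp (D : {fset nat}) (P : pteam D) : team D := [set s | 0 < P s].

Definition Pr (D : {fset nat}) (P : pteam D) (E : pred (asg D)) : R :=
  \sum_(s | E s) P s.

Definition cPr (D : {fset nat}) (P : pteam D) (E G : pred (asg D)) : R :=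
  Pr P (predI E G) / Pr P G.

Definition is_at (D : {fset nat}) (xs : seq nat) (a : seq A) : pred (asg D) :=
  fun s => vals s xs == a.

Definition ex_pteam (D : {fset nat}) (P : pteam D) (x : nat)
    (F : asg D -> A -> R) : pteam (x |` D) :=
  [ffun s' => \sum_(s : asg D) \sum_(a : A | upd s x a == s') P s * F s a].

Definition all_pteam (D : {fset nat}) (P : pteam D) (x : nat) :
    pteam (x |` D) :=
  [ffun s' => \sum_(s : asg D) \sum_(a : A | upd s x a == s') P s / #|A|%:R].

Fixpoint psat (phi : formula L) : forall D : {fset nat}, pteam D -> Prop :=
  match phi with
  | Lit l => fun D P => forall s, s \in psupp P -> lit_holds s l
  | Dep xs ys => fun D P => forall a : seq A, 0 < Pr P (is_at xs a) ->
      exists b : seq A, cPr P (is_at ys b) (is_at xs a) = 1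
  | Ind xs zs ys => fun D P => forall a b c : seq A, 0 < Pr P (is_at zs c) ->
      cPr P (predI (is_at xs a) (is_at ys b)) (is_at zs c)
      = cPr P (is_at xs a) (is_at zs c) * cPr P (is_at ys b) (is_at zs c)
  | And p q => fun D P => psat p P /\ psat q P
  (* The first two cases are the degenerate splits, of weight 1 and 0. *)
  | Or p q => fun D P => psat p P \/ psat q P \/
      exists (Y Z : pteam D) (r : R),
        [/\ distr Y, distr Z, 0 < r < 1,
            (forall s, P s = r * Y s + (1 - r) * Z s) & psat p Y /\ psat q Z]
  | Exists x p => fun D P => exists F : asg D -> A -> R,
      (forall s, s \in psupp P -> distr (F s)) /\ psat p (ex_pteam P x F)
  | Forall x p => fun D P => psat p (all_pteam P x)
  end.

End Semantics.

Definition entails_rel (L : signature) (psi phi : formula L) : Prop :=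
  forall (A : structure L) (D : {fset nat}) (X : team A D),
    fv psi `|` fv phi `<=` D -> sat psi X -> sat phi X.

Definition entails_prob (R : realType) (L : signature) (psi phi : formula L) :
    Prop :=
  forall (A : structure L) (D : {fset nat}) (P : pteam A R D),
    fv psi `|` fv phi `<=` D -> distr P -> psat psi P -> psat phi P.

(* Main.v *)
Require Import Defs.
From mathcomp Require Import all_boot all_order all_algebra finmap reals.
From mathcomp Require Import zify ring lra.

(** Probabilistic satisfaction passes to the support. For dependence logic it
    passes back: overlaps of a split are shared evenly and witness sets get the
    uniform distribution, so that every nonempty team is the support of a
    probabilistic team with the same theory. This gives (1)-(3).

    For (4), the premises a _|_ b, c _|_a e, d _|_b e, c _|_e d give c _|_ d in
    teams by gluing rows (the row having the a of the first and the b of the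
    second assignment supplies a common e), but a probabilistic team can satisfy
    them with c and d correlated through e. Conversely, Studeny's premises
    a _|_cd b, c _|_a d, c _|_b d, a _|_ b give c _|_ d in probabilistic teams
    by an entropy argument, carried out here with AM-GM in place of logarithms,
    but not in teams. *)

Set Implicit Arguments.
Unset Strict Implicit.
Unset Printing Implicit Defensive.
Import Order.TTheory GRing.Theory Num.Theory.
Local Open Scope fset_scope.
Local Open Scope ring_scope.

(** * Transfer between a probabilistic team and its support *)

Lemma sum_gt0P (R : realType) (T : finType) (Q : pred T) (F : T -> R) :
  (forall t, 0 <= F t) ->
  reflect (exists2 t, Q t & 0 < F t) (0 < \sum_(t | Q t) F t).
Proof.
move=> F0; apply: (iffP idP) => [|[t Qt Ft]].
  rewrite lt0r psumr_neq0 => [/andP[/hasP[t _ /andP[Qt Ft]] _]|//].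
  by exists t.
by rewrite (bigD1 t) //= ltr_wpDr // sumr_ge0.
Qed.

Lemma indep_ratio (R : realType) (u v t w : R) : w != 0 ->
  u / w = (v / w) * (t / w) <-> u * w = v * t.
Proof.
move=> w0; split=> E.
  have -> : u * w = u / w * w ^+ 2 by field.
  by rewrite E; field.
have -> : u = v * t / w by rewrite -E mulfK.
by field.
Qed.

Section Transfer.
Variables (L : signature) (A : structure L) (R : realType).
Implicit Types (D : {fset nat}) (phi : formula L).

(** No distribution has empty support, so the empty team needs separate treatment; it also fills the
    empty side of a degenerate split. *)
Lemma sat_set0 phi D : sat phi (set0 : team A D).
Proof.
elim: phi D => [l|xs ys|xs zs ys|p IHp q IHq|p IHp q IHq|x p IHp|x p IHp] D /=.
- by move=> s; rewrite inE.
- by move=> s s'; rewrite inE.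
- by move=> s s'; rewrite inE.
- by split.
- by exists set0, set0; rewrite setU0.
- exists (fun=> set0); split=> [s|]; first by rewrite inE.
  suff -> : ex_team (set0 : team A D) x (fun=> set0) = set0 by [].
  by apply/setP=> s; rewrite inE; apply/imset2P => -[? ? /[!inE]].
- suff -> : all_team (set0 : team A D) x = set0 by [].
  by apply/setP=> s; rewrite inE; apply/imset2P => -[? ? /[!inE]].
Qed.

(** * Supports of quantifier extensions *)

Lemma eq_ex_team D (X : team A D) x (F G : asg A D -> {set A}) :
  (forall s, s \in X -> F s = G s) -> ex_team X x F = ex_team X x G.
Proof.
move=> FG; apply/setP=> s'.
by apply/imset2P/imset2P => -[s a Xs Fa ->]; exists s a;
  rewrite // ?FG // -FG.
Qed.

(** [F] is constrained only on the support of [P]; elsewhere the factor [P s] vanishes, so every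
    product [P s * F s a] is nonnegative. *)
Lemma psupp_ex_pteam D (P : pteam A R D) x (F : asg A D -> A -> R) :
  (forall s, 0 <= P s) -> (forall s, s \in psupp P -> distr (F s)) ->
  psupp (ex_pteam P x F) = ex_team (psupp P) x (fun s => [set a | 0 < F s a]).
Proof.
move=> P0 dF.
have PF0 s a : 0 <= P s * F s a.
  case: (ltgtP 0 (P s)) (P0 s) => // [Ps _|<- _]; last by rewrite mul0r.
  by apply: mulr_ge0; [exact: ltW|apply: (dF s _).1; rewrite inE].
have PF s a : 0 < P s * F s a -> 0 < P s /\ 0 < F s a.
  case: (ltgtP 0 (P s)) (P0 s) => // [Ps _|<- _]; last by rewrite mul0r ltxx.
  by rewrite pmulr_rgt0.
apply/setP=> s'; rewrite inE ffunE; apply/sum_gt0P/imset2P.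
- by move=> s; apply: sumr_ge0.
- move=> [s _ /sum_gt0P[//|a /eqP <- /PF[Ps Fa]]].
  by exists s a; rewrite ?inE.
- move=> [s a /[!inE] Ps Fa ->]; exists s => //; apply/sum_gt0P => //.
  by exists a => //; apply: mulr_gt0.
Qed.

Lemma distr_ex_pteam D (P : pteam A R D) x (F : asg A D -> A -> R) :
  distr P -> (forall s, s \in psupp P -> distr (F s)) ->
  distr (ex_pteam P x F).
Proof.
move=> [P0 P1] dF; split=> [s'|].
  rewrite ffunE; apply: sumr_ge0 => s _; apply: sumr_ge0 => a _.
  case: (ltgtP 0 (P s)) (P0 s) => // [Ps _|<- _]; last by rewrite mul0r.
  by apply: mulr_ge0; [exact: ltW|apply: (dF s _).1; rewrite inE].
under eq_bigr do rewrite ffunE.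
rewrite exchange_big -P1; apply: eq_bigr => s _ /=.
under eq_bigr do rewrite big_mkcond.
rewrite exchange_big /=.
under eq_bigr => a _ do rewrite -big_mkcond (big_pred1 (upd s x a)) //=.
rewrite -mulr_sumr.
case: (ltgtP 0 (P s)) (P0 s) => // [Ps _|<- _]; last by rewrite mul0r.
by rewrite (dF s _).2 ?mulr1 // inE.
Qed.

Lemma distr_unif (T : finType) (B : {set T}) : B != set0 ->
  distr (fun t => if t \in B then #|B|%:R^-1 else 0 : R).
Proof.
rewrite -card_gt0 => B0; split=> [t|]; first by case: ifP; rewrite ?invr_ge0.
rewrite -big_mkcond sumr_const -[LHS]mulr_natr mulVf //.
by rewrite pnatr_eq0 -lt0n.
Qed.

Lemma unif_gt0 (T : finType) (B : {set T}) t : B != set0 ->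
  (0 < (if t \in B then #|B|%:R^-1 else 0 : R)) = (t \in B).
Proof.
by rewrite -card_gt0 => B0; case: ifP; rewrite ?ltxx // invr_gt0 ltr0n.
Qed.

Lemma all_pteamE D (P : pteam A R D) x :
  all_pteam P x =
  ex_pteam P x (fun _ a => if a \in [set: A] then #|[set: A]|%:R^-1 else 0).
Proof.
apply/ffunP=> s'; rewrite !ffunE; apply: eq_bigr => s _; apply: eq_bigr => a _.
by rewrite inE cardsT.
Qed.

Lemma univT_neq0 : [set: A] != set0.
Proof. by apply/set0Pn; exists (pt A). Qed.

Lemma distr_all_pteam D (P : pteam A R D) x :
  distr P -> distr (all_pteam P x).
Proof.
move=> dP; rewrite all_pteamE; apply: distr_ex_pteam => // s _.
exact: distr_unif univT_neq0.
Qed.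

Lemma psupp_all_pteam D (P : pteam A R D) x : (forall s, 0 <= P s) ->
  psupp (all_pteam P x) = all_team (psupp P) x.
Proof.
move=> P0; rewrite all_pteamE psupp_ex_pteam //; last first.
  by move=> s _; apply: distr_unif univT_neq0.
apply: eq_ex_team => s _; apply/setP => a.
by rewrite inE unif_gt0 // univT_neq0.
Qed.

(** * Probabilities of events and the two semantics *)

Lemma Pr_ge0 D (P : pteam A R D) E : (forall s, 0 <= P s) -> 0 <= Pr P E.
Proof. by move=> P0; apply: sumr_ge0. Qed.

Lemma Pr_le D (P : pteam A R D) (E G : pred (asg A D)) :
  (forall s, 0 <= P s) -> (forall s, E s -> G s) -> Pr P E <= Pr P G.
Proof.
move=> P0 EG; rewrite /Pr [leRHS](bigID E) /= -[leLHS]addr0.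
rewrite lerD ?sumr_ge0 // [leRHS](eq_bigl E) // => s.
by case Es: (E s); rewrite ?andbF // EG.
Qed.

(** Clearing denominators loses nothing: if the conditioning event is null, both products vanish. *)
Lemma psat_IndP D (P : pteam A R D) xs zs ys : (forall s, 0 <= P s) ->
  psat (@Ind L xs zs ys) P <->
  forall a b c : seq A,
    Pr P (predI (predI (is_at xs a) (is_at ys b)) (is_at zs c))
      * Pr P (is_at zs c)
    = Pr P (predI (is_at xs a) (is_at zs c))
      * Pr P (predI (is_at ys b) (is_at zs c)).
Proof.
move=> P0; split=> [H a b c|H a b c Pc].
  have [Pc|] := ltP 0 (Pr P (is_at zs c)); last first.
    move=> Pc; have Z E : Pr P (predI E (is_at zs c)) = 0.
      apply/le_anti; rewrite Pr_ge0 // andbT (le_trans _ Pc) // Pr_le //.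
      by move=> s /andP[].
    by rewrite !Z !mul0r.
  by apply/(indep_ratio _ _ _ (lt0r_neq0 Pc)); apply: H.
exact/(indep_ratio _ _ _ (lt0r_neq0 Pc)).
Qed.

Lemma Pr_gt0P D (P : pteam A R D) (E : pred (asg A D)) :
  (forall s, 0 <= P s) ->
  reflect (exists2 s, E s & s \in psupp P) (0 < Pr P E).
Proof.
move=> P0; apply: (iffP (sum_gt0P _ P0)) => -[s Es Ps];
  by exists s; rewrite // inE in Ps *.
Qed.

Lemma psat_sat phi D (P : pteam A R D) : distr P ->
  psat phi P -> sat phi (psupp P).
Proof.
elim: phi D P => [l|xs ys|xs zs ys|p IHp q IHq|p IHp q IHq|x p IHp|x p IHp] D P dP; have [P0 P1] := dP.
- by [].
- move=> /= H s s' Ps Ps' E.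
  have [|b Hb] := H (vals s xs).
    by apply/Pr_gt0P => //; exists s => //; rewrite /is_at.
  suff det t : t \in psupp P -> vals t xs = vals s xs -> vals t ys = b.
    by rewrite !det.
  move=> Pt Et; apply/eqP/negPn/negP => tb.
  have G0 : 0 < Pr P (is_at xs (vals s xs)).
    by apply/Pr_gt0P => //; exists t => //; rewrite /is_at Et.
  move: Hb => /(canRL (divfK _)); rewrite mul1r gt_eqF // => /(_ isT) Hb.
  have : 0 < \sum_(u | is_at xs (vals s xs) u && ~~ is_at ys b u) P u.
    by apply/Pr_gt0P => //; exists t => //; rewrite /is_at Et eqxx.
  move: Hb; rewrite /Pr [in RHS](bigID (is_at ys b)) /=.
  under eq_bigl do rewrite andbC.
  by move=> /eqP; rewrite -subr_eq0 opprD addrA subrr add0r oppr_eq0 => /eqP ->;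
    rewrite ltxx.
- move=> /(psat_IndP _ _ _ P0) H s s' Ps Ps' E.
  (* The product of marginals is positive, as [s] and [s'] witness, so the joint event has positive
     mass and contains a supported assignment. *)
  have /esym Habc := H (vals s xs) (vals s' ys) (vals s zs).
  have : 0 < Pr P (predI (predI (is_at xs (vals s xs)) (is_at ys (vals s' ys)))
                     (is_at zs (vals s zs))) * Pr P (is_at zs (vals s zs)).
    rewrite -Habc mulr_gt0 //; apply/Pr_gt0P => //.
      by exists s => //=; rewrite /is_at !eqxx.
    by exists s' => //=; rewrite /is_at E !eqxx.
  rewrite lt0r mulf_eq0 negb_or => /andP[/andP[N _] _].
  have /Pr_gt0P[//|t /andP[/andP[/eqP ? /eqP ?] /eqP ?] Pt] :
    0 < Pr P (predI (predI (is_at xs (vals s xs)) (is_at ys (vals s' ys)))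
                     (is_at zs (vals s zs))) by rewrite lt0r N Pr_ge0.
  by exists t.
- by move=> [/IHp-Hp /IHq-Hq]; split; [apply: Hp|apply: Hq].
- move=> /= [/IHp-Hp|[/IHq-Hq|[Y [Z [r [dY dZ /andP[r0 r1] PE [pY qZ]]]]]]].
  + by exists (psupp P), set0; rewrite setU0; split; [|apply: Hp|apply: sat_set0].
  + by exists set0, (psupp P); rewrite set0U; split; [|apply: sat_set0|apply: Hq].
  exists (psupp Y), (psupp Z); split; [|exact: IHp dY pY|exact: IHq dZ qZ].
  apply/setP=> s; rewrite !inE PE.
  have := dY.1 s; have := dZ.1 s; have r1' : 0 < 1 - r by rewrite subr_gt0.
  case: (ltgtP 0 (Y s)) => //= [Ys Zs _|<-]; last by rewrite mulr0 add0r pmulr_rgt0.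
  by rewrite ltr_pwDl ?mulr_gt0 // mulr_ge0 // ltW.
- move=> /= [F [dF pF]]; exists (fun s => [set a | 0 < F s a]); split.
    move=> s Ps; have [F0 F1] := dF s Ps.
    have /sum_gt0P[//|a _ Fa] : 0 < \sum_a F s a by rewrite F1.
    by apply/set0Pn; exists a; rewrite inE.
  by rewrite -psupp_ex_pteam //; apply: IHp pF; apply: distr_ex_pteam.
- by move=> /= pP; rewrite -psupp_all_pteam //; apply: IHp pP; apply: distr_all_pteam.
Qed.

Lemma sat_psat phi D (P : pteam A R D) : FOdep phi -> distr P ->
  sat phi (psupp P) -> psat phi P.
Proof.
elim: phi D P => [l|xs ys|xs zs ys|p IHp q IHq|p IHp q IHq|x p IHp|x p IHp] D P //=
  Fp dP; have [P0 P1] := dP.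
- move=> H a Pa; have /Pr_gt0P[//|s /eqP sa Ps] := Pa; exists (vals s ys).
  apply: (canLR (mulfK _)); rewrite ?gt_eqF // mul1r /Pr [LHS]big_mkcond [RHS]big_mkcond.
  apply: eq_bigr => t _ /=; rewrite andbC.
  case: (eqVneq (P t) 0) (P0 t) => [->|Pt0 Ptge]; first by rewrite !if_same.
  rewrite /is_at; case: eqP => //= ta.
  by rewrite (H t s) ?eqxx // ?sa // inE lt0r Pt0.
- by case/andP: Fp => Fp Fq [/IHp-Hp /IHq-Hq]; split; [apply: Hp|apply: Hq].
- case/andP: Fp => Fp Fq [Y [Z [XE pY qZ]]].
  (* A half equal to the whole support gives a degenerate split; otherwise each half has an
     assignment outside the other, so both weights are positive. *)
  have [YX|nYX] := boolP (Y == psupp P).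
    by left; apply: IHp => //; rewrite -(eqP YX).
  have [ZX|nZX] := boolP (Z == psupp P).
    by right; left; apply: IHq => //; rewrite -(eqP ZX).
  have subne (V W : team A D) : psupp P = V :|: W -> W != psupp P ->
      exists s, [/\ s \in V, s \notin W & 0 < P s].
    move=> E; rewrite eqEsubset E subsetUr /= => /subsetPn[s].
    rewrite !inE => /orP[Vs|->//] Ws; exists s; split=> //.
    by have /setP/(_ s) := E; rewrite !inE Vs.
  have [y [yY yZ Py]] := subne _ _ XE nZX.
  have [|z [zZ zY Pz]] := subne Z Y _ nYX; first by rewrite setUC.
  (* The share of the mass of [s] given to [V]: half on the overlap with [W], all on the rest of
     [V]. *)
  pose h (V W : team A D) s : R :=
    if s \in V then (if s \in W then 2%:R^-1 else 1) else 0.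
  have h0 V W s : 0 <= h V W s.
    by rewrite /h; do 2?case: ifP => _ //; rewrite invr_ge0.
  have hS (V W : team A D) s : s \in V -> 0 < h V W s.
    by rewrite /h => ->; case: ifP => _ //; rewrite invr_gt0.
  have hD s : s \in psupp P -> h Y Z s + h Z Y s = 1.
    by rewrite XE inE /h; do 2?case: ifP => _ //=; rewrite ?addr0 ?add0r // => _; lra.
  pose r V W := \sum_s P s * h V W s.
  have r0 (V W : team A D) s : 0 < P s -> s \in V -> 0 < r V W.
    move=> Ps Vs; apply/sum_gt0P => [u|]; first by rewrite mulr_ge0.
    by exists s => //; rewrite mulr_gt0 // hS.
  have rD : r Y Z + r Z Y = 1.
    rewrite -P1 -big_split; apply: eq_bigr => s _ /=; rewrite -mulrDr.
    case: (ltgtP 0 (P s)) (P0 s) => // [Ps _|<- _]; last by rewrite mul0r.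
    by rewrite hD ?mulr1 // inE.
  have rY := r0 Y Z y Py yY; have rZ := r0 Z Y z Pz zZ.
  pose Q V W : pteam A R D := [ffun s => P s * h V W s / r V W].
  have dQ V W : 0 < r V W -> distr (Q V W).
    move=> rV; split=> [s|]; first by rewrite ffunE divr_ge0 ?mulr_ge0 // ltW.
    under eq_bigr do rewrite ffunE.
    by rewrite -mulr_suml divff // gt_eqF.
  have sQ (V W : team A D) : 0 < r V W -> V \subset psupp P -> psupp (Q V W) = V.
    move=> rV /subsetP VP; apply/setP=> s; rewrite inE ffunE.
    rewrite pmulr_lgt0 ?invr_gt0 //.
    have [Vs|nVs] := boolP (s \in V).
      by have := VP s Vs; rewrite inE => Ps; rewrite mulr_gt0 // hS.
    by rewrite /h (negPf nVs) mulr0 ltxx.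
  right; right; exists (Q Y Z), (Q Z Y), (r Y Z); split.
  + exact: dQ.
  + exact: dQ.
  + by rewrite rY /= -rD ltrDl.
  + move=> s; rewrite -[1]rD addrAC subrr add0r !ffunE.
    rewrite ![r _ _ * _]mulrC !divfK ?gt_eqF // -mulrDr.
    case: (ltgtP 0 (P s)) (P0 s) => // [Ps _|<- _]; last by rewrite mul0r.
    by rewrite hD ?mulr1 // inE.
  + split; [apply: IHp => //|apply: IHq => //]; rewrite ?sQ // ?XE ?subsetUl ?subsetUr //; exact: dQ.
- move=> [F [F0 pF]].
  pose G s a : R := if a \in F s then #|F s|%:R^-1 else 0.
  have dG s : s \in psupp P -> distr (G s) by move=> /F0; apply: distr_unif.
  exists G; split=> //; apply: IHp => //; first exact: distr_ex_pteam.
  rewrite psupp_ex_pteam // (@eq_ex_team _ _ _ _ F) // => s Xs.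
  by apply/setP=> a; rewrite inE unif_gt0 // F0.
- by move=> pX; apply: IHp; rewrite ?psupp_all_pteam //; apply: distr_all_pteam.
Qed.

Lemma psupp_unif D (X : team A D) : X != set0 ->
  exists2 P : pteam A R D, distr P & psupp P = X.
Proof.
move=> X0; have [U0 U1] := distr_unif X0.
exists [ffun s => if s \in X then #|X|%:R^-1 else 0].
  split=> [s|]; first by rewrite ffunE.
  by under eq_bigr do rewrite ffunE.
by apply/setP=> s; rewrite inE ffunE unif_gt0.
Qed.

End Transfer.

Lemma entails_rel_prob (R : realType) (L : signature) (psi phi : formula L) :
  FOdep phi -> entails_rel psi phi -> entails_prob R psi phi.
Proof.
move=> Fphi H A D P fvD dP pP.
exact/(sat_psat Fphi)/H/psat_sat.
Qed.

(** A nonempty team is realised by its uniform distribution, to which [psi] lifts because it is in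
    dependence logic. *)
Lemma entails_prob_rel (R : realType) (L : signature) (psi phi : formula L) :
  FOdep psi -> entails_prob R psi phi -> entails_rel psi phi.
Proof.
move=> Fpsi H A D X fvD.
have [->|/(psupp_unif R)[P dP <-]] := eqVneq X set0.
  by move=> _; apply: sat_set0.
by move=> pX; exact: psat_sat dP (H _ _ _ fvD dP (sat_psat Fpsi dP pX)).
Qed.

(** * Conditional independence and density ratios *)

(** AM-GM for pairs, used twice: with [u = t1 + t2] and [v = t3 + t4], it gives [u * v >= 4], and
    then [(u + v) ^+ 2 >= 4 * (u * v)]. In the equality case the discarded squares vanish, so
    [t1 = t2] and [u = v = 2]. *)
Lemma AGM4 (R : realType) (t1 t2 t3 t4 : R) :
  0 < t1 -> 0 < t2 -> 0 < t3 -> 0 < t4 -> t1 * t2 * t3 * t4 = 1 ->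
  4 <= t1 + t2 + t3 + t4 /\ (t1 + t2 + t3 + t4 = 4 -> t1 = 1).
Proof.
move=> p1 p2 p3 p4 E.
set u := t1 + t2; set v := t3 + t4.
have u0 : 0 < u by rewrite addr_gt0.
have v0 : 0 < v by rewrite addr_gt0.
have Eu : u ^+ 2 = 4 * (t1 * t2) + (t1 - t2) ^+ 2 by rewrite /u; ring.
have Ev : v ^+ 2 = 4 * (t3 * t4) + (t3 - t4) ^+ 2 by rewrite /v; ring.
have x0 := sqr_ge0 (t1 - t2); have y0 := sqr_ge0 (t3 - t4).
have q0 : 0 < t1 * t2 by rewrite mulr_gt0.
have r0 : 0 < t3 * t4 by rewrite mulr_gt0.
have qr : t1 * t2 * (t3 * t4) = 1 by rewrite mulrA.
have uv2 : (u * v) ^+ 2 = 16 + (4 * (t1 * t2)) * (t3 - t4) ^+ 2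
    + (t1 - t2) ^+ 2 * v ^+ 2.
  rewrite exprMn Eu mulrDl; congr (_ + _).
  rewrite Ev mulrDr; congr (_ + _).
  by transitivity (16 * (t1 * t2 * (t3 * t4))); [ring|rewrite qr mulr1].
have z1 : 0 <= (4 * (t1 * t2)) * (t3 - t4) ^+ 2 by rewrite mulr_ge0 // ltW // mulr_gt0.
have z2 : 0 <= (t1 - t2) ^+ 2 * v ^+ 2 by rewrite mulr_ge0 // sqr_ge0.
have uv0 : 0 < u * v by rewrite mulr_gt0.
have uv4 : 4 <= u * v.
  by rewrite leNgt; apply/negP => lt4; nra.
have S : (u + v) ^+ 2 = 4 * (u * v) + (u - v) ^+ 2 by ring.
have w0 := sqr_ge0 (u - v).
have -> : t1 + t2 + t3 + t4 = u + v by rewrite /u /v; ring.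
split; first by rewrite leNgt; apply/negP => lt4; nra.
move=> E4.
have uv4' : u * v = 4 by rewrite E4 in S; lra.
have z20 : (t1 - t2) ^+ 2 * v ^+ 2 = 0 by rewrite uv4' in uv2; lra.
have /eqP : (u - v) ^+ 2 = 0 by rewrite E4 uv4' in S; lra.
rewrite sqrf_eq0 subr_eq0 => /eqP uvE.
move/eqP: z20; rewrite mulf_eq0 !sqrf_eq0 (gt_eqF v0) orbF subr_eq0 => /eqP t12.
by move: E4; rewrite -uvE /u -t12; lra.
Qed.

(** * Marginals and pointwise independence *)

Section Marginals.
Variables (L : signature) (A : structure L) (R : realType) (D : {fset nat}).
Variable P : pteam A R D.
Hypothesis dP : distr P.
Implicit Types (s t : asg A D) (xs ys zs : seq nat).

Let P0 : forall s, 0 <= P s := dP.1.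

(** The value tuple is read off from [s], so that marginals of different tuples can be multiplied
    pointwise. *)
Definition marg xs s : R := Pr P (is_at xs (vals s xs)).

Lemma vals_catE s t xs ys :
  (vals s (xs ++ ys) == vals t (xs ++ ys)) =
  (vals s xs == vals t xs) && (vals s ys == vals t ys).
Proof. by rewrite /vals !map_cat eqseq_cat ?size_map. Qed.

Lemma eq_marg xs ys : xs =i ys -> marg xs =1 marg ys.
Proof.
move=> xy s; apply: eq_bigl => t; rewrite /is_at.
by apply/eqP/eqP => /eq_in_map E; apply/eq_in_map => x xin; apply: E;
  rewrite ?xy // -xy.
Qed.

Lemma marg_vals xs s t : vals s xs = vals t xs -> marg xs s = marg xs t.
Proof. by rewrite /marg => ->. Qed.

Lemma marg_ge0 xs s : 0 <= marg xs s.
Proof. exact: Pr_ge0. Qed.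

Lemma marg_gt0 xs s : 0 < P s -> 0 < marg xs s.
Proof.
by move=> Ps; apply/Pr_gt0P => //; exists s; rewrite ?inE // /is_at.
Qed.

Lemma marg_nil s : marg [::] s = 1.
Proof. by rewrite -dP.2; apply: eq_bigl. Qed.

(** If [a] and [b] both occur with [c], the relational half supplies a supported assignment
    realising all three, and the pointwise identity applies there; otherwise both products
    vanish. *)
Lemma psat_IndE xs zs ys :
  psat (@Ind L xs zs ys) P <->
  sat (@Ind L xs zs ys) (psupp P) /\
  forall s, s \in psupp P ->
    marg (xs ++ ys ++ zs) s * marg zs s = marg (xs ++ zs) s * marg (ys ++ zs) s.
Proof.
have PrE (a b c : seq A) s : vals s xs = a -> vals s ys = b -> vals s zs = c ->
    [/\ Pr P (predI (predI (is_at xs a) (is_at ys b)) (is_at zs c))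
          = marg (xs ++ ys ++ zs) s,
        Pr P (predI (is_at xs a) (is_at zs c)) = marg (xs ++ zs) s &
        Pr P (predI (is_at ys b) (is_at zs c)) = marg (ys ++ zs) s].
  move=> <- <- <-; split; apply: eq_bigl => t; rewrite /= /is_at !vals_catE //.
  by rewrite andbA.
split=> [pI|[sI fI]].
  split; first exact: psat_sat pI.
  move=> s Ps; move/(psat_IndP _ _ _ P0): pI => pI.
  by have [<- <- <-] := PrE _ _ _ s erefl erefl erefl; apply: pI.
apply/(psat_IndP _ _ _ P0) => a b c.
set pa := predI (is_at xs a) (is_at zs c); set pb := predI (is_at ys b) _.
have [/(Pr_gt0P _ P0)[s1 /andP[/eqP xa /eqP zc] Ps1]|a0] := boolP (0 < Pr P pa).
  have [/(Pr_gt0P _ P0)[s2 /andP[/eqP yb /eqP zc2] Ps2]|b0] := boolP (0 < Pr P pb).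
    have [|s [Ps sz sx sy]] := sI s1 s2 Ps1 Ps2; first by rewrite zc zc2.
    rewrite /pa /pb; have [|||-> -> ->] := PrE a b c s; rewrite ?sx ?sy ?sz //.
    by rewrite -fI // /marg sz zc.
  have -> : Pr P pb = 0 by apply/eqP; rewrite eq_le Pr_ge0 // andbT leNgt.
  rewrite mulr0; suff -> : Pr P (predI (predI (is_at xs a) (is_at ys b)) (is_at zs c)) = 0.
    by rewrite mul0r.
  apply/eqP; rewrite eq_le Pr_ge0 // andbT leNgt; apply: contra b0 => H.
  by apply: (lt_le_trans H); apply: Pr_le => // s /andP[/andP[_ ?] ?]; apply/andP.
have -> : Pr P pa = 0 by apply/eqP; rewrite eq_le Pr_ge0 // andbT leNgt.
rewrite mul0r; suff -> : Pr P (predI (predI (is_at xs a) (is_at ys b)) (is_at zs c)) = 0.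
  by rewrite mul0r.
apply/eqP; rewrite eq_le Pr_ge0 // andbT leNgt; apply: contra a0 => H.
by apply: (lt_le_trans H); apply: Pr_le => // s /andP[/andP[? _] ?]; apply/andP.
Qed.

(* The density of the conditionally independent coupling of [xs] and [ys]     *)
(* given [zs] with respect to [P].                                            *)
Definition ratio xs zs ys s : R :=
  marg (xs ++ zs) s * marg (ys ++ zs) s / (marg (xs ++ ys ++ zs) s * marg zs s).

Lemma ratio_gt0 xs zs ys s : 0 < P s -> 0 < ratio xs zs ys s.
Proof. by move=> Ps; rewrite divr_gt0 // mulr_gt0 // marg_gt0. Qed.

(* 1 if the value of [xs] in [s1] and that of [ys] in [s2] occur together in   *)
(* the support of [P] with their common value of [zs], and 0 otherwise.        *)
Definition hit xs zs ys s1 s2 : R :=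
  \sum_(s | (vals s (xs ++ zs) == vals s1 (xs ++ zs))
         && (vals s (ys ++ zs) == vals s2 (ys ++ zs))) P s / marg (xs ++ ys ++ zs) s.

(** The index set is empty or a single class of assignments agreeing on [xs ++ ys ++ zs], where the
    denominator is constant and equals the mass of the class. *)
Lemma hit_le1 xs zs ys s1 s2 : hit xs zs ys s1 s2 <= 1.
Proof.
pose C s := (vals s (xs ++ zs) == vals s1 (xs ++ zs))
         && (vals s (ys ++ zs) == vals s2 (ys ++ zs)).
rewrite /hit (eq_bigl C) //.
case: (pickP C) => [s0 C0|C0]; last by rewrite big_pred0.
have CE s : C s = is_at (xs ++ ys ++ zs) (vals s0 (xs ++ ys ++ zs)) s.
  move: C0; rewrite /C /is_at !vals_catE.
  case/andP => /andP[/eqP <- /eqP <-] /andP[/eqP <- /eqP <-].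
  by do 3?case: (vals s _ == _).
rewrite (eq_bigl _ _ CE).
rewrite (eq_bigr (fun s => P s / marg (xs ++ ys ++ zs) s0)) => [|s /eqP E]; last first.
  by rewrite (marg_vals E).
rewrite -mulr_suml -/(Pr _ _) -/(marg _ _).
by have [->|?] := eqVneq (marg (xs ++ ys ++ zs) s0) 0; rewrite ?mul0r ?divff.
Qed.

(** The two marginals in the numerator expand into sums over [s1] and [s2]; the sum over [s], moved
    inside, becomes [hit]. *)
Lemma sum_ratio xs zs ys : \sum_s P s * ratio xs zs ys s =
  \sum_s1 \sum_(s2 | vals s2 zs == vals s1 zs)
    P s1 * P s2 / marg zs s1 * hit xs zs ys s1 s2.
Proof.
pose G s s1 s2 := if (vals s (xs ++ zs) == vals s1 (xs ++ zs))
         && (vals s (ys ++ zs) == vals s2 (ys ++ zs))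
  then P s * P s1 * P s2 / (marg (xs ++ ys ++ zs) s * marg zs s) else 0.
transitivity (\sum_s \sum_s1 \sum_s2 G s s1 s2).
  apply: eq_bigr => s _.
  rewrite /ratio /G; set Q := marg _ s * marg zs s.
  rewrite /marg /Pr big_distrlr mulr_suml mulr_sumr big_mkcond.
  apply: eq_bigr => s1 _; rewrite /is_at [_ == vals s _]eq_sym.
  case: eqP => _ /=; last by rewrite big1_eq.
  rewrite mulr_suml mulr_sumr big_mkcond; apply: eq_bigr => s2 _.
  by rewrite [_ == vals s _]eq_sym; case: ifP => // _; ring.
rewrite exchange_big; apply: eq_bigr => s1 _ /=.
rewrite exchange_big [RHS]big_mkcond; apply: eq_bigr => s2 _ /=.
case: eqP => z12; last first.
  apply: big1 => s _; rewrite /G !vals_catE; case: ifP => // /andP[].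
  by case/andP=> _ /eqP E1 /andP[_ /eqP E2]; case: z12; rewrite -E1 -E2.
rewrite /hit mulr_sumr [RHS]big_mkcond; apply: eq_bigr => s _.
rewrite /G; case: ifP => //; rewrite !vals_catE => /andP[/andP[_ /eqP E] _].
by rewrite (marg_vals E) invfM; ring.
Qed.

Lemma sum_coupling zs :
  \sum_s1 \sum_(s2 | vals s2 zs == vals s1 zs) P s1 * P s2 / marg zs s1 = 1.
Proof.
rewrite -dP.2; apply: eq_bigr => s _; rewrite -mulr_suml -mulr_sumr -/(Pr _ _).
rewrite -/(marg zs s) -mulrA.
case: (ltgtP 0 (P s)) (P0 s) => // [Ps _|<- _]; last by rewrite mul0r.
by rewrite divff ?mulr1 // gt_eqF // marg_gt0.
Qed.

Lemma coupling_ge0 zs s1 s2 : 0 <= P s1 * P s2 / marg zs s1.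
Proof. by rewrite divr_ge0 ?mulr_ge0 // marg_ge0. Qed.

Lemma sum_ratio_le1 xs zs ys : \sum_s P s * ratio xs zs ys s <= 1.
Proof.
rewrite sum_ratio -(sum_coupling zs); apply: ler_sum => s1 _.
apply: ler_sum => s2 _; rewrite -[leRHS]mulr1.
by rewrite ler_wpM2l ?coupling_ge0 ?hit_le1.
Qed.

(** A mean ratio of 1 leaves no loss in [hit_le1], so [hit] is 1 on every pair to which the coupling
    gives mass. This yields the relational half of [psat_IndE]; the numerical half is the hypothesis
    with denominators cleared. *)
Lemma ratio1_psat xs zs ys :
  (forall s, 0 < P s -> ratio xs zs ys s = 1) -> psat (@Ind L xs zs ys) P.
Proof.
move=> r1; apply/psat_IndE; split=> [s1 s2|s]; rewrite !inE; last first.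
  move=> Ps; have := r1 s Ps; rewrite /ratio => /(canRL (divfK _)).
  by rewrite mul1r mulf_neq0 ?gt_eqF ?marg_gt0 // => /(_ isT).
move=> Ps1 Ps2 z12.
have S1 : \sum_s P s * ratio xs zs ys s = 1.
  rewrite -[RHS]dP.2; apply: eq_bigr => s _.
  case: (ltgtP 0 (P s)) (P0 s) => // [Ps _|<- _]; last by rewrite mul0r.
  by rewrite r1 ?mulr1.
pose def t1 t2 := P t1 * P t2 / marg zs t1 * (1 - hit xs zs ys t1 t2).
have def0 t1 t2 : 0 <= def t1 t2.
  by rewrite mulr_ge0 ?coupling_ge0 // subr_ge0 hit_le1.
have : \sum_t1 \sum_(t2 | vals t2 zs == vals t1 zs) def t1 t2 = 0.
  transitivity (1 - 1 : R); last by rewrite subrr.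
  rewrite -{1}(sum_coupling zs) -S1 sum_ratio -sumrB; apply: eq_bigr => t1 _.
  by rewrite -sumrB; apply: eq_bigr => t2 _; rewrite /def mulrBr mulr1.
move/psumr_eq0P => /(_ (fun t1 _ => sumr_ge0 _ (fun t2 _ => def0 t1 t2))).
move=> /(_ s1 isT)/psumr_eq0P => /(_ (fun t2 _ => def0 s1 t2)) /(_ s2).
rewrite z12 eqxx => /(_ isT)/eqP; rewrite mulf_eq0 gt_eqF ?divr_gt0 ?mulr_gt0 ?marg_gt0 //=.
rewrite subr_eq0 => /eqP hE.
have /sum_gt0P[s|s] : 0 < hit xs zs ys s1 s2 by rewrite -hE.
  by rewrite divr_ge0 ?marg_ge0.
rewrite !vals_catE => /andP[/andP[/eqP ? /eqP ?] /andP[/eqP ? _]] Hs.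
exists s; split; rewrite -?z12 // inE lt0r P0 andbT; apply/eqP => Ps0.
by move: Hs; rewrite Ps0 mul0r ltxx.
Qed.

Lemma psat_Ind_marg xs zs ys s : psat (@Ind L xs zs ys) P -> s \in psupp P ->
  marg (xs ++ ys ++ zs) s * marg zs s = marg (xs ++ zs) s * marg (ys ++ zs) s.
Proof. by move=> /psat_IndE[_]; apply. Qed.

End Marginals.

(* The premises say that the product of the ratios for c _|_ d, c _|_ab d,     *)
(* a _|_c b and a _|_d b is 1 on the support; each of them has mean at most 1, *)
(* so AM-GM makes all four equal to 1.                                         *)
Lemma studeny_prob (R : realType) (L : signature) a b c d :
  entails_prob R
    (And (Ind L [:: a] [:: c; d] [:: b]) (And (Ind L [:: c] [:: a] [:: d])
      (And (Ind L [:: c] [:: b] [:: d]) (Ind L [:: a] [::] [:: b]))))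
    (Ind L [:: c] [::] [:: d]).
Proof.
move=> A D P _ dP; have [P0 P1] := dP.
move=> [Hab [Ha [Hb H0]]]; apply: ratio1_psat => //.
pose K s := ratio P [:: c] [::] [:: d] s + ratio P [:: c] [:: a; b] [:: d] s
  + ratio P [:: a] [:: c] [:: b] s + ratio P [:: a] [:: d] [:: b] s.
have key s : 0 < P s -> 4 <= K s /\ (K s = 4 -> ratio P [:: c] [::] [:: d] s = 1).
  move=> Ps; have Xs : s \in psupp P by rewrite inE.
  apply: AGM4; rewrite ?ratio_gt0 //.
  have := psat_Ind_marg dP Hab Xs; have := psat_Ind_marg dP Ha Xs.
  have := psat_Ind_marg dP Hb Xs; have := psat_Ind_marg dP H0 Xs.
  rewrite /ratio /= !(marg_nil dP) !mulr1.
  (* Marginals are brought to a fixed order of variables, so that the goal becomes an identity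
     between fifteen nonzero numbers. *)
  have margP (xs ys : seq nat) : perm_eq xs ys -> marg P xs s = marg P ys s.
    by move=> /perm_mem/eq_marg ->.
  rewrite (margP [:: c; d; a; b] [:: a; b; c; d]); last first.
    by apply/permP => p /=; lia.
  rewrite (margP [:: c; d; a] [:: a; c; d]); last by apply/permP => p /=; lia.
  rewrite (margP [:: c; d; b] [:: b; c; d]); last by apply/permP => p /=; lia.
  rewrite (margP [:: c; a; b] [:: a; b; c]); last by apply/permP => p /=; lia.
  rewrite (margP [:: d; a; b] [:: a; b; d]); last by apply/permP => p /=; lia.
  rewrite (margP [:: c; a] [:: a; c]); last by apply/permP => p /=; lia.
  rewrite (margP [:: d; a] [:: a; d]); last by apply/permP => p /=; lia.
  rewrite (margP [:: c; b] [:: b; c]); last by apply/permP => p /=; lia.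
  rewrite (margP [:: d; b] [:: b; d]); last by apply/permP => p /=; lia.
  have n0 xs : marg P xs s != 0 by rewrite gt_eqF ?marg_gt0.
  move: (n0 [:: a; b; c; d]) (n0 [:: a; c; d]) (n0 [:: b; c; d]) (n0 [:: a; b; c])
    (n0 [:: a; b; d]) (n0 [:: a; b]) (n0 [:: a; c]) (n0 [:: a; d]) (n0 [:: b; c])
    (n0 [:: b; d]) (n0 [:: c; d]) (n0 [:: a]) (n0 [:: b]) (n0 [:: c]) (n0 [:: d]).
  move: (marg P [:: a; b; c; d] s) (marg P [:: a; c; d] s) (marg P [:: b; c; d] s)
    (marg P [:: a; b; c] s) (marg P [:: a; b; d] s) (marg P [:: a; b] s)
    (marg P [:: a; c] s) (marg P [:: a; d] s) (marg P [:: b; c] s)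
    (marg P [:: b; d] s) (marg P [:: c; d] s) (marg P [:: a] s) (marg P [:: b] s)
    (marg P [:: c] s) (marg P [:: d] s).
  move=> abcd acd bcd abc abd ab ac ad bc bd cd a' b' c' d' ? ? ? ? ? ? ? ? ? ? ? ? ? ? ?.
  move=> E1 E2 E3 E4.
  (* In the product of the four ratios [abc], [abd], [c'] and [d'] cancel; the premises equate what
     remains. *)
  have F : ac * ad * (bc * bd) = abcd * cd * ab.
    by rewrite E4 E1 -E3 -E2; ring.
  transitivity (ac * ad * (bc * bd) / (abcd * cd * ab)); first by field; do ?[apply/andP; split].
  by rewrite F divff // !mulf_neq0.
have K0 s : 0 <= P s * (K s - 4).
  case: (ltgtP 0 (P s)) (P0 s) => // [Ps _|<- _]; last by rewrite mul0r.
  by rewrite mulr_ge0 // subr_ge0; case: (key s Ps).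
have KS : \sum_s P s * (K s - 4) <= 0.
  have -> : \sum_s P s * (K s - 4) =
     \sum_s P s * ratio P [:: c] [::] [:: d] s + \sum_s P s * ratio P [:: c] [:: a; b] [:: d] s
    + \sum_s P s * ratio P [:: a] [:: c] [:: b] s + \sum_s P s * ratio P [:: a] [:: d] [:: b] s
    - \sum_s P s * 4.
    by rewrite -!big_split -sumrB; apply: eq_bigr => s _ /=; rewrite /K; ring.
  rewrite -mulr_suml P1.
  have := sum_ratio_le1 dP [:: c] [::] [:: d].
  have := sum_ratio_le1 dP [:: c] [:: a; b] [:: d].
  have := sum_ratio_le1 dP [:: a] [:: c] [:: b].
  have := sum_ratio_le1 dP [:: a] [:: d] [:: b].
  lra.
move=> s Ps; have [_] := key s Ps; apply.
(* Nonnegative terms with nonpositive sum all vanish, so every supported [s] is in the equality case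
   of AM-GM. *)
have /psumr_eq0P : \sum_s P s * (K s - 4) = 0.
  by apply/eqP; rewrite eq_le KS sumr_ge0.
move=> /(_ (fun s _ => K0 s))/(_ s isT)/eqP.
by rewrite mulf_eq0 gt_eqF //= subr_eq0 => /eqP.
Qed.

(** * Counterexamples *)

Lemma chase_rel (L : signature) a b c d e :
  entails_rel
    (And (Ind L [:: a] [::] [:: b]) (And (Ind L [:: c] [:: a] [:: e])
      (And (Ind L [:: d] [:: b] [:: e]) (Ind L [:: c] [:: e] [:: d]))))
    (Ind L [:: c] [::] [:: d]).
Proof.
move=> A D X _ [Hab [Hca [Hdb Hcd]]] s1 s2 X1 X2 _.
(* [s3] joins the [a] of [s1] to the [b] of [s2]; [s4] and [s5] carry its [e] with the [c] of [s1]
   and the [d] of [s2]. *)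
have [s3 [X3 _ a3 b3]] := Hab s1 s2 X1 X2 erefl.
have [s4 [X4 _ c4 e4]] := Hca s1 s3 X1 X3 (esym a3).
have [s5 [X5 _ d5 e5]] := Hdb s2 s3 X2 X3 (esym b3).
have [s6 [X6 _ c6 d6]] := Hcd s4 s5 X4 X5 (etrans e4 (esym e5)).
by exists s6; split; rewrite ?c6 ?d6.
Qed.

(* Teams over a two-element universe with variables 0, ..., 4, given by a     *)
(* list of rows; repetitions of a row are weights.                            *)
Section BoolTeams.
Variables (L : signature) (R : realType).

Definition bool_structure : structure L :=
  @Structure L bool false (fun _ _ => false) (fun _ _ => false).

Definition bdom : {fset nat} := [fset x in iota 0 5].

(** Missing entries read as [false], so in a team given by lists of length four the variable 4 is
    constant. *)
Definition row (l : seq bool) : asg bool_structure bdom :=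
  [ffun y => nth false l (val y)].

Definition proj (l : seq bool) (xs : seq nat) : seq bool :=
  [seq nth false l x | x <- xs].

Lemma vals_row l xs : all (ltn^~ 5) xs -> vals (row l) xs = proj l xs.
Proof.
move=> /allP xs5; apply/eq_in_map => x /xs5 x5; rewrite /val_at.
have xD : x \in bdom by rewrite in_fset mem_iota.
by rewrite insubT ffunE.
Qed.

Variable rows : seq (seq bool).

Definition rows_ind_rel xs zs ys : bool :=
  all (fun l => all (fun l' => (proj l zs == proj l' zs) ==>
    has (fun l'' => [&& proj l'' zs == proj l zs, proj l'' xs == proj l xs
                      & proj l'' ys == proj l' ys]) rows) rows) rows.

Definition rows_count xs l : nat :=
  count (fun l' => proj l' xs == proj l xs) rows.

(** All marginals have denominator [size rows], so the identity of [psat_IndE] becomes one between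
    counts and is decided by computation. *)
Definition rows_ind_prob xs zs ys : bool :=
  rows_ind_rel xs zs ys &&
  all (fun l => rows_count (xs ++ ys ++ zs) l * rows_count zs l ==
                rows_count (xs ++ zs) l * rows_count (ys ++ zs) l)%N rows.

Definition rows_team : team bool_structure bdom :=
  [set s | s \in map row rows].

Definition rows_pteam : pteam bool_structure R bdom :=
  [ffun s => (count_mem s (map row rows))%:R / (size rows)%:R].

Lemma sat_rows xs zs ys : all (ltn^~ 5) (xs ++ ys ++ zs) ->
  sat (Ind L xs zs ys) rows_team <-> rows_ind_rel xs zs ys.
Proof.
rewrite !all_cat => /and3P[x5 y5 z5]; split.
  move=> H; apply/allP => l lr; apply/allP => l' lr'; apply/implyP => /eqP E.
  have inX m : m \in rows -> row m \in rows_team by move=> mr; rewrite inE map_f.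
  have [|s []] := H _ _ (inX _ lr) (inX _ lr'); first by rewrite !vals_row.
  rewrite inE => /mapP[l'' lr'' ->]; rewrite !vals_row // => E1 E2 E3.
  by apply/hasP; exists l''; rewrite // E1 E2 E3 !eqxx.
move=> /allP H s s'; rewrite !inE => /mapP[l lr ->] /mapP[l' lr' ->].
rewrite !vals_row // => E; have /allP/(_ l' lr')/implyP := H l lr.
rewrite E eqxx => /(_ isT)/hasP[l'' lr'' /and3P[/eqP ? /eqP ? /eqP ?]].
by exists (row l''); split; rewrite ?vals_row // inE map_f.
Qed.

Lemma Pr_rows E : Pr rows_pteam E = (count (E \o row) rows)%:R / (size rows)%:R.
Proof.
rewrite /Pr; under eq_bigr do rewrite ffunE.
rewrite -mulr_suml; congr (_ / _).
elim: rows => [|l r IH] /=; first by rewrite big1.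
under eq_bigr do rewrite natrD.
rewrite big_split /= IH natrD; congr (_ + _).
rewrite big_mkcond (bigD1 (row l)) //= big1 => [|s sl]; first by rewrite eqxx addr0; case: (E _).
by rewrite eq_sym (negPf sl) if_same.
Qed.

Hypothesis rows_neq0 : (0 < size rows)%N.

Let n0 : (size rows)%:R != 0 :> R.
Proof. by rewrite pnatr_eq0 -lt0n. Qed.

Lemma distr_rows : distr rows_pteam.
Proof.
split=> [s|]; first by rewrite ffunE divr_ge0.
by have := Pr_rows predT; rewrite /Pr => ->; rewrite count_predT divff.
Qed.

Lemma psupp_rows : psupp rows_pteam = rows_team.
Proof.
apply/setP=> s; rewrite !inE ffunE pmulr_lgt0 ?invr_gt0 ?ltr0n //.
by rewrite -has_count has_pred1.
Qed.

Lemma marg_rows xs l : all (ltn^~ 5) xs ->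
  marg rows_pteam xs (row l) = (rows_count xs l)%:R / (size rows)%:R.
Proof.
move=> x5; rewrite /marg Pr_rows; congr (_%:R / _); apply: eq_count => l' /=.
by rewrite /is_at !vals_row.
Qed.

Lemma psat_rows xs zs ys : all (ltn^~ 5) (xs ++ ys ++ zs) ->
  psat (Ind L xs zs ys) rows_pteam <-> rows_ind_prob xs zs ys.
Proof.
move=> xyz5; have := xyz5; rewrite !all_cat => /and3P[x5 y5 z5].
have fE l : (marg rows_pteam (xs ++ ys ++ zs) (row l) * marg rows_pteam zs (row l)
   = marg rows_pteam (xs ++ zs) (row l) * marg rows_pteam (ys ++ zs) (row l)) <->
   (rows_count (xs ++ ys ++ zs) l * rows_count zs l ==
                rows_count (xs ++ zs) l * rows_count (ys ++ zs) l)%N.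
  rewrite !marg_rows ?all_cat ?x5 ?y5 ?z5 //.
  have N0 : (size rows * size rows)%:R != 0 :> R by rewrite natrM mulf_neq0.
  rewrite !mulf_div -!natrM; split=> [/(mulIf (invr_neq0 N0))/eqP|/eqP -> //].
  by rewrite eqr_nat.
split=> [/(psat_IndE distr_rows)[]|/andP[sI /allP fI]].
  rewrite psupp_rows => /(sat_rows xyz5) sI fI; apply/andP; split=> //.
  by apply/allP => l lr; apply/fE/fI; rewrite inE map_f.
apply/(psat_IndE distr_rows); rewrite psupp_rows; split; first exact/sat_rows.
by move=> s; rewrite inE => /mapP[l lr ->]; apply/fE/fI.
Qed.

End BoolTeams.

Lemma chase_not_prob (R : realType) (L : signature) :
  ~ entails_prob R
    (And (Ind L [:: 0] [::] [:: 1]) (And (Ind L [:: 2] [:: 0] [:: 4])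
      (And (Ind L [:: 3] [:: 1] [:: 4]) (Ind L [:: 2] [:: 4] [:: 3]))))%N
    (Ind L [:: 2] [::] [:: 3])%N.
Proof.
pose F := false; pose T := true.
(* 0 and 1 are independent fair coins and 4 is their conjunction. Given        *)
(* 4 = F, the variables 2 and 3 are independent with probability 2/3 of T;     *)
(* given 4 = T, both are T. Hence 2 and 3 are correlated.                      *)
pose rows := [:: [:: F; F; F; F; F]] ++ nseq 2 [:: F; F; T; T; F]
  ++ nseq 2 [:: F; T; F; T; F] ++ [:: [:: F; T; T; T; F]]
  ++ nseq 2 [:: T; F; T; F; F] ++ [:: [:: T; F; T; T; F]]
  ++ nseq 3 [:: T; T; T; T; T].
move=> /(_ _ bdom (rows_pteam L R rows)) H.
(* Each of 2 and 3 is [T] in 9 of the 12 rows, and both are in 7, while [7 * 12] differs from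
   [9 * 9]. *)
suff /(psat_rows _ _ _) : psat (Ind L [:: 2] [::] [:: 3])%N (rows_pteam L R rows).
  by move=> /(_ isT isT).
apply: H; first by apply/fsubsetP => x; rewrite !inE; lia.
  exact: distr_rows.
by do ?split; apply/psat_rows.
Qed.

Lemma studeny_not_rel (L : signature) :
  ~ entails_rel
    (And (Ind L [:: 0] [:: 2; 3] [:: 1]) (And (Ind L [:: 2] [:: 0] [:: 3])
      (And (Ind L [:: 2] [:: 1] [:: 3]) (Ind L [:: 0] [::] [:: 1]))))%N
    (Ind L [:: 2] [::] [:: 3])%N.
Proof.
pose F := false; pose T := true.
(* 0 and 1 are arbitrary, 2 = T forces 0 = 1 = T, and 3 = T forces 0 = 1 = F.  *)
pose rows := [:: [:: F; F; F; F]; [:: F; F; F; T]; [:: T; T; F; F];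
  [:: T; T; T; F]; [:: F; T; F; F]; [:: T; F; F; F]].
move=> /(_ _ bdom (rows_team L rows)) H.
(* No row has [T] at both 2 and 3. *)
suff /(sat_rows _ _) : sat (Ind L [:: 2] [::] [:: 3])%N (rows_team L rows).
  by move=> /(_ isT).
apply: H; first by apply/fsubsetP => x; rewrite !inE; lia.
by do ?split; apply/sat_rows.
Qed.

Theorem theorem3p7 (R : realType) (L : signature) :
  (forall psi phi : formula L, FOdep psi -> FOdep phi ->
     (entails_rel psi phi <-> entails_prob R psi phi)) /\
  (forall psi phi : formula L, FOdep psi -> FOind phi ->
     entails_prob R psi phi -> entails_rel psi phi) /\
  (forall psi phi : formula L, FOind psi -> FOdep phi ->
     entails_rel psi phi -> entails_prob R psi phi) /\
  (exists psi phi : formula L, ind_conj psi /\ ind_conj phi /\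
     entails_rel psi phi /\ ~ entails_prob R psi phi) /\
  (exists psi phi : formula L, ind_conj psi /\ ind_conj phi /\
     entails_prob R psi phi /\ ~ entails_rel psi phi).
Proof.
split=> [psi phi Fpsi Fphi|].
  by split; [apply: entails_rel_prob|apply: entails_prob_rel].
split=> [psi phi Fpsi _|]; first exact: entails_prob_rel.
split=> [psi phi _ Fphi|]; first exact: entails_rel_prob.
(* The formulas stay open at first: each entailment holds for arbitrary variables, and the matching
   counterexample then fixes them. *)
split; do 2!eexists.
  by do 3?split; [| |apply: chase_rel|apply: chase_not_prob].
by do 3?split; [| |apply: studeny_prob|apply: studeny_not_rel].
Qed.
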